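(* Let $n\ge 2$ and $r\le -1$. If $(U_1,\dots,U_n)$ follows an extremal mixture copula with vector $(a_1,\dots,a_{2^{n-1}})\in\Delta_{2^{n-1}}$ such that $a_1<1$, then $M^{\mathbf w}_{r}(U_1,\dots,U_n)$ is strictly sub-uniform for all $\mathbf w\in\Delta_n^+$.
   Context: $\Delta_k=\{(w_1,\dots,w_k)\in[0,1]^k: w_1+\dots+w_k=1\}$ and $\Delta_k^+=\Delta_k\cap(0,1)^k$; $[n]=\{1,\dots,n\}$. For $r\in\mathbb R\setminus\{0\}$ and $\mathbf w=(w_1,\dots,w_n)\in\Delta_n$, the weighted $r$-mean is $M^{\mathbf w}_r(u_1,\dots,u_n)=(w_1u_1^r+\dots+w_nu_n^r)^{1/r}$ for $(u_1,\dots,u_n)\in(0,\infty)^n$. A non-negative random variable $X$ is strictly sub-uniform if $\mathbb P(X\le p)>p$ for all $p\in(0,1)$. A copula is a joint distribution function of random variables each uniformly distributed on $(0,1)$. A random vector $(U_1,\dots,U_n)$ follows an extremal copula with index set $J\subseteq[n]$ if it has the same joint distribution as the vector whose $j$-th component is $\mathbf 1_{\{j\in J\}}U+\mathbf 1_{\{j\in J^c\}}(1-U)$, $j\in[n]$, where $U$ is uniform on $(0,1)$. For $i\in\{1,\dots,2^{n-1}\}$, let $\mathbf s_i\in\{0,1\}^n$ be the vector of digits of the $n$-digit binary representation (with leading zeros) of the number $i-1$, let $J_i\subseteq[n]$ be the set of indices of the zeros in $\mathbf s_i$, and let $C^{(i)}$ be the extremal copula with index set $J_i$ (so $J_1=[n]$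 and $C^{(1)}$ is the comonotonicity copula). A copula $C$ is an extremal mixture copula with vector $(a_1,\dots,a_{2^{n-1}})\in\Delta_{2^{n-1}}$ if $C=\sum_{i=1}^{2^{n-1}}a_iC^{(i)}$. *)

(* Defs.v *)
From HB Require Import structures.
From mathcomp Require Import all_boot all_order all_algebra.
From mathcomp Require Import all_classical all_reals all_analysis.

Set Implicit Arguments.
Unset Strict Implicit.
Unset Printing Implicit Defensive.

Import Order.TTheory GRing.Theory Num.Theory.
Import numFieldNormedType.Exports.

Local Open Scope classical_set_scope.
Local Open Scope ring_scope.

(* Components and weights are indexed from 0: the index j : 'I_n stands for
   j + 1 in [n], and i : 'I_(2 ^ n.-1) for i + 1 in {1, ..., 2 ^ (n - 1)}. *)

Definition simplex (R : realType) (k : nat) : set ('I_k -> R) :=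
  [set w | (forall i, 0 <= w i <= 1) /\ \sum_(i < k) w i = 1].

Definition open_simplex (R : realType) (k : nat) : set ('I_k -> R) :=
  [set w | simplex w /\ forall i, 0 < w i < 1].

(* The mean is only meaningful for r != 0 and positive u; powR is total and
   always nonnegative, so the values elsewhere are conventional. *)
Definition weighted_mean (R : realType) (n : nat) (r : R) (w u : 'I_n -> R) : R :=
  (\sum_(j < n) w j * u j `^ r) `^ r^-1.

Definition strictly_sub_uniform (R : realType) (d : measure_display)
    (T : measurableType d) (P : probability T R) (X : T -> R) : Prop :=
  [/\ measurable_fun setT X,
      forall t, 0 <= X t
    & forall p : R, 0 < p < 1 -> (p%:E < P [set t | (X t <= p)%R])%E].

Definition joint_cdf (R : realType) (d : measure_display)
    (T : measurableType d) (P : probability T R) (n : nat)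
    (X : 'I_n -> T -> R) (x : 'I_n -> R) : \bar R :=
  P [set t | forall j, X j t <= x j].

(* The joint distribution function, on all of R^n, of the vector with
   components U (j in J) and 1 - U (j not in J), where U is the identity on
   R equipped with the uniform probability. *)
Definition extremal_copula (R : realType) (n : nat) (J : {set 'I_n}) :
    ('I_n -> R) -> \bar R :=
  joint_cdf (uniform_prob (@ltr01 R))
    (fun j (u : R) => if j \in J then u else 1 - u).

(* Digit j (most significant first, j = 0, ..., n - 1) of the n-digit binary
   representation of k < 2 ^ n. *)
Definition binary_digit (n k : nat) (j : 'I_n) : bool :=
  odd (k %/ 2 ^ (n - j.+1)).

Definition extremal_index_set (n : nat) (i : 'I_(2 ^ n.-1)) : {set 'I_n} :=
  [set j | ~~ binary_digit i j]%SET.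

Definition extremal_mixture_copula (R : realType) (n : nat)
    (a : 'I_(2 ^ n.-1) -> R) (x : 'I_n -> R) : \bar R :=
  (\sum_(i < 2 ^ n.-1) (a i)%:E * extremal_copula (extremal_index_set i) x)%E.

Fact expn2_gt0 (m : nat) : (0 < 2 ^ m)%N.
Proof. by rewrite expn_gt0. Qed.

(* The index of the comonotonicity copula: its index set is all of 'I_n. *)
Definition comonotone_index (n : nat) : 'I_(2 ^ n.-1) :=
  Ordinal (expn2_gt0 n.-1).

(* Main.v *)
Require Import Defs.
From HB Require Import structures.
From mathcomp Require Import all_boot all_order all_algebra.
From mathcomp Require Import all_classical all_reals all_analysis.
From mathcomp Require Import measurable_realfun.
From mathcomp Require Import lra ring.

Set Implicit Arguments.
Unset Strict Implicit.
Unset Printing Implicit Defensive.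

Import Order.TTheory GRing.Theory Num.Theory.
Import numFieldNormedType.Exports.

Local Open Scope classical_set_scope.
Local Open Scope ring_scope.

(** A function of the whole vector (U_1, ..., U_n) is studied through its joint
    distribution function only, so the law of the vector is first identified.
    Lower orthants are stable under intersection, hence a law on R^n is
    determined by its distribution function, and [mixture_law_of_cdf] turns the
    equality of copulas into P(M <= p) = \sum_i a_i P_i(M <= p), where P_i is
    the law of the extremal vector of index set J_i.

    Fix i and let W be the total weight of J_i. On the extremal vector the mean
    is (W u^r + (1 - W) (1 - u)^r)^(1/r) with u uniform. As r <= -1, it is at
    most the harmonic mean (W/u + (1 - W)/(1 - u))^-1
    ([power_mean_le_harmonic]), and clearing denominators, the latter is at most
    p as soon as
      u^2 - (1 - p (1 - 2 W)) u + p W >= 0.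
    This quadratic has discriminant D = 1 - 2 p + p^2 (1 - 2 W)^2, so it can
    only be negative on an interval of length sqrt D (or nowhere if D < 0), and
    P_i(M <= p) >= 1 - sqrt D ([extremal_vector_law_ge]). Since
      (1 - p)^2 - D = 4 p^2 W (1 - W),
    this lower bound is at least p, and larger than p when 0 < W < 1.

    The first binary digit of i - 1 < 2^(n-1) is 0, so J_i is never empty; it is
    all of [n] only for i = 1. Hence every i != 1 has 0 < W < 1, and a_1 < 1
    gives positive mass to such an i, which makes the inequality strict. *)

(** * Laws on R^n and their distribution functions *)

Definition lower_orthants (R : realType) (n : nat) : set (set ('I_n -> R)) :=
  [set A | exists c : 'I_n -> R, A = [set x | forall j, x j <= c j]].

(** The functions 'I_n -> R with the sigma-algebra generated by the lower
    orthants, i.e. the Borel sets of R^n: presented by these generators, it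
    makes the joint distribution function visibly determine the law. *)
Definition orthant_space (R : realType) (n : nat) :=
  g_sigma_algebraType (@lower_orthants R n).

Lemma lower_orthants_setI_closed (R : realType) (n : nat) :
  setI_closed (@lower_orthants R n).
Proof.
move=> _ _ [c ->] [c' ->]; exists (fun j => Num.min (c j) (c' j)).
apply/seteqP; split => x /=.
  by move=> [xc xc'] j; rewrite le_min xc xc'.
by move=> xcc'; split => j; move: (xcc' j); rewrite le_min => /andP[].
Qed.

Lemma exists_nat_upper_bound (R : realType) (n : nat) (x : 'I_n -> R) :
  exists k : nat, forall j, x j <= k%:R.
Proof.
exists (\max_j Num.bound `|x j|)%N => j.
apply: le_trans (ler_norm _) _; apply: ltW.
apply: lt_le_trans (archi_boundP (normr_ge0 _)) _.
by rewrite ler_nat; exact: (leq_bigmax j).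
Qed.

(** Uniqueness of measures from a generating pi-system requires a countable
    cover by generators of finite measure. *)
Lemma bigcup_nat_orthants (R : realType) (n : nat) :
  \bigcup_k [set x : 'I_n -> R | forall j, x j <= k%:R] = setT.
Proof.
apply/seteqP; split => // x _; have [k xk] := exists_nat_upper_bound x.
by exists k.
Qed.

(** A half-space x_j <= c is the increasing union of the lower orthants whose
    bounds are c at j and k elsewhere; this is what makes the generated
    sigma-algebra as large as the Borel one. *)
Lemma measurable_coordinate (R : realType) (n : nat) (j : 'I_n) :
  measurable_fun setT (fun x : orthant_space R n => x j).
Proof.
apply: (measurability _ (measurable_realfun.RGenOInfty.measurableE R)).
move=> _ [_ [c ->] <-].
rewrite setTI -setCitvl preimage_setC; apply: measurableC.
rewrite [X in measurable X](_ : _ =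
    \bigcup_k [set x | forall i, x i <= (if i == j then c else k%:R)]).
  apply: bigcupT_measurable => k; apply: sub_sigma_algebra.
  by exists (fun i => if i == j then c else k%:R).
apply/seteqP; split => x /=.
  rewrite in_itv/= => xc; have [k xk] := exists_nat_upper_bound x.
  by exists k => // i; case: eqP => [->|_].
by move=> [k _ /(_ j)]; rewrite eqxx in_itv.
Qed.

Lemma measurable_vector (R : realType) (n : nat) (d : measure_display)
    (T : measurableType d) (X : 'I_n -> T -> R) :
  (forall j, measurable_fun setT (X j)) ->
  measurable_fun setT (fun t => (X ^~ t) : orthant_space R n).
Proof.
move=> mX; apply: (measurability (rT := orthant_space R n)
  (@lower_orthants R n)) => // _ [_ [c ->] <-].
rewrite setTI (_ : _ @^-1` _ =
    \bigcap_(j : 'I_n) (X j @^-1` `]-oo, c j]%classic)).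
  by apply: fin_bigcap_measurable => // j _; rewrite -[X in measurable X]setTI;
     exact: mX.
apply/seteqP; split => t /=.
  by move=> Xc j _ /=; rewrite in_itv/=.
by move=> Xc j; move: (Xc j I); rewrite /= in_itv.
Qed.

(** Both sides are finite measures of [A] on [orthant_space], and by hypothesis
    they agree on the pi-system of lower orthants, which generates. *)
Lemma mixture_law_of_cdf (R : realType) (n N : nat)
    (d : measure_display) (T : measurableType d) (P : probability T R)
    (X : 'I_n -> T -> R)
    (d' : measure_display) (T' : measurableType d') (Q : probability T' R)
    (Y : 'I_N -> 'I_n -> T' -> R) (a : 'I_N -> R) :
  (forall j, measurable_fun setT (X j)) ->
  (forall i j, measurable_fun setT (Y i j)) ->
  (forall i, 0 <= a i) ->
  (forall x, joint_cdf P X x = (\sum_i (a i)%:E * joint_cdf Q (Y i) x)%E) ->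
  forall A : set (orthant_space R n), measurable A ->
    P [set t | A (X ^~ t)] = (\sum_i (a i)%:E * Q [set t | A (Y i ^~ t)])%E.
Proof.
move=> mX mY a_ge0 XY A mA.
pose law (d0 : measure_display) (T0 : measurableType d0)
    (P0 : probability T0 R) (Z : 'I_n -> T0 -> R)
    (mZ : forall j, measurable_fun setT (Z j)) :
    probability (orthant_space R n) R :=
  distribution P0 (mfun_Sub (mem_set (measurable_vector mZ))).
pose comp i : {measure set (orthant_space R n) -> \bar R} :=
  mscale (NngNum (a_ge0 i)) (law _ _ Q _ (mY i)).
(* [msum] sums a sequence of measures, so the family is extended by zero. *)
pose comp_nat (k : nat) : {measure set (orthant_space R n) -> \bar R} :=
  oapp comp mzero (insub k).
have mixE B : msum comp_nat N B =
    (\sum_i (a i)%:E * Q [set t | B (Y i ^~ t)])%E.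
  by apply: eq_bigr => i _; rewrite /comp_nat valK.
rewrite -mixE -[LHS]/(law _ _ P _ mX A).
apply: (@measure_unique _ R (orthant_space R n) (@lower_orthants R n)
  (fun k => [set x | forall j, x j <= k%:R]) _ _ _ _
  (law _ _ P _ mX) (msum comp_nat N)) => //.
- exact: lower_orthants_setI_closed.
- by move=> k; exists (fun=> k%:R).
- exact: bigcup_nat_orthants.
- by move=> _ [c ->]; apply: etrans (esym (mixE _)); exact: XY.
- move=> k; apply: le_lt_trans (probability_le1 _ _) (ltry 1).
  by apply: sub_sigma_algebra; exists (fun=> k%:R).
Qed.

Lemma measurable_weighted_mean (R : realType) (n : nat) (r : R)
    (w : 'I_n -> R) :
  measurable_fun setT (fun x : orthant_space R n => weighted_mean r w x).
Proof.
apply: (measurableT_comp (measurable_powR _)).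
apply: measurable_sum => j; apply: measurable_funM => //.
apply: (measurableT_comp (measurable_powR _)); exact: measurable_coordinate.
Qed.

(** * The power mean of two values *)

(** Convexity of t |-> t^(-r), as -r >= 1, applied at 1/x and 1/y. *)
Lemma power_mean_le_harmonic (R : realType) (r W x y : R) :
  r <= -1 -> 0 <= W <= 1 -> 0 < x -> 0 < y ->
  (W * x `^ r + (1 - W) * y `^ r) `^ r^-1 <= (W / x + (1 - W) / y)^-1.
Proof.
move=> r1 W01 x0 y0; pose s := - r.
have s1 : 1 <= s by rewrite /s; lra.
have xV0 : 0 < x^-1 by rewrite invr_gt0.
have yV0 : 0 < y^-1 by rewrite invr_gt0.
have powE z : 0 < z -> z `^ r = z^-1 `^ s.
  by move=> z0; rewrite -(powR_inv1 (ltW z0)) -powRrM mulN1r opprK.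
have h0 : 0 < W / x + (1 - W) / y by nra.
have := convex_powR s1 (Itv01 (andP W01).1 (andP W01).2)
  (x := x^-1) (y := y^-1).
rewrite !inE /= !in_itv/= !andbT (ltW xV0) (ltW yV0) => /(_ isT isT).
rewrite [leRHS]convRE /= -!powE// => jensen_conv.
have jensen : (W / x + (1 - W) / y) `^ s <= W * x `^ r + (1 - W) * y `^ r.
  exact: jensen_conv.
have pow_h_gt0 := powR_gt0 s h0.
have sum_gt0 := lt_le_trans pow_h_gt0 jensen.
have s0 : 0 < s by lra.
have -> : r^-1 = - s^-1 by rewrite /s invrN opprK.
rewrite powRN lef_pV2 ?posrE ?powR_gt0//.
have -> : W / x + (1 - W) / y = ((W / x + (1 - W) / y) `^ s) `^ s^-1.
  by rewrite -powRrM mulfV ?gt_eqF// powRr1// ltW.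
apply: ge0_ler_powR; rewrite ?nnegrE ?invr_ge0 ?powR_ge0//; exact: ltW.
Qed.

(** After clearing denominators the conclusion is
    u^2 - (1 - p (1 - 2 W)) u + p W >= 0; completing the square, four times this
    quadratic is (2 u - (1 - p (1 - 2 W)))^2 - D with D the radicand. A negative
    D is covered too, because its square root is then 0. *)
Lemma harmonic_mean_le (R : realType) (W p u : R) :
  0 <= W <= 1 -> 0 < p -> 0 < u < 1 ->
  Num.sqrt (1 - 2 * p + p ^+ 2 * (1 - 2 * W) ^+ 2)
    <= `|2 * u - (1 - p * (1 - 2 * W))| ->
  (W / u + (1 - W) / (1 - u))^-1 <= p.
Proof.
move=> W01 p0 u01 far.
have quadratic : u * (1 - u) <= p * (W * (1 - u) + (1 - W) * u).
  have := ler_pM (sqrtr_ge0 _) (sqrtr_ge0 _) far far.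
  rewrite -!expr2 real_normK ?num_real// => /(le_trans _) far2.
  have : 1 - 2 * p + p ^+ 2 * (1 - 2 * W) ^+ 2 <=
      (2 * u - (1 - p * (1 - 2 * W))) ^+ 2.
    apply: far2.
    have [D0|/ltW D0] := leP 0 (1 - 2 * p + p ^+ 2 * (1 - 2 * W) ^+ 2).
      by rewrite sqr_sqrtr.
    by rewrite (le_trans D0)// sqr_ge0.
  nra.
have u0 : 0 < u by lra.
have u1 : 0 < 1 - u by lra.
have -> : W / u + (1 - W) / (1 - u) =
    (W * (1 - u) + (1 - W) * u) / (u * (1 - u)).
  by field; rewrite !gt_eqF.
have num0 : 0 < W * (1 - u) + (1 - W) * u by nra.
by rewrite invf_div ler_pdivrMr.
Qed.

(** The gap between (1 - p)^2 and the radicand is 4 p^2 W (1 - W), which is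
    nonnegative here and positive in the strict version below. *)
Lemma excluded_length_le (R : realType) (W p : R) :
  0 <= W <= 1 -> 0 < p < 1 ->
  Num.sqrt (1 - 2 * p + p ^+ 2 * (1 - 2 * W) ^+ 2) <= 1 - p.
Proof.
move=> W01 p01; have p1 : 0 <= 1 - p by lra.
rewrite -[leRHS](ger0_norm p1) -sqrtr_sqr; apply: ler_wsqrtr.
suff : 0 <= p ^+ 2 * (W * (1 - W)) by nra.
by rewrite mulr_ge0 ?sqr_ge0// mulr_ge0; lra.
Qed.

Lemma excluded_length_lt (R : realType) (W p : R) :
  0 < W < 1 -> 0 < p < 1 ->
  Num.sqrt (1 - 2 * p + p ^+ 2 * (1 - 2 * W) ^+ 2) < 1 - p.
Proof.
move=> W01 p01; have p1 : 0 < 1 - p by lra.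
rewrite -[ltRHS](ger0_norm (ltW p1)) -sqrtr_sqr ltr_sqrt ?exprn_gt0//.
suff : 0 < p ^+ 2 * (W * (1 - W)) by nra.
by rewrite mulr_gt0 ?exprn_gt0 ?mulr_gt0//; lra.
Qed.

Lemma simplex_sum_bounds (R : realType) (n : nat) (w : 'I_n -> R)
    (J : {set 'I_n}) : simplex w -> 0 <= \sum_(j in J) w j <= 1.
Proof.
move=> [w01 w1]; have w_ge0 j : 0 <= w j by case/andP: (w01 j).
by rewrite sumr_ge0//= -w1 [leRHS](bigID (mem J)) /= lerDl sumr_ge0.
Qed.

Lemma weighted_mean_two_valued (R : realType) (n : nat) (r : R)
    (w : 'I_n -> R) (J : {set 'I_n}) (x y : R) :
  \sum_j w j = 1 ->
  weighted_mean r w (fun j => if j \in J then x else y) =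
  ((\sum_(j in J) w j) * x `^ r + (1 - \sum_(j in J) w j) * y `^ r) `^ r^-1.
Proof.
move=> w1; congr (_ `^ _); rewrite (bigID (mem J)) /=; congr +%R.
  by rewrite mulr_suml; apply: eq_bigr => j ->.
have -> : 1 - \sum_(j in J) w j = \sum_(j | j \notin J) w j.
  by rewrite -w1 [in LHS](bigID (mem J)) /= addrAC subrr add0r.
by rewrite mulr_suml; apply: eq_bigr => j /negbTE ->.
Qed.

Lemma mixed_weight_bounds (R : realType) (n : nat) (w : 'I_n -> R)
    (J : {set 'I_n}) (j j' : 'I_n) :
  open_simplex w -> j \in J -> j' \notin J -> 0 < \sum_(k in J) w k < 1.
Proof.
move=> [[_ w1] w01] jJ j'J.
have w_ge0 k : 0 <= w k by case/andP: (w01 k) => /ltW.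
apply/andP; split.
  rewrite (bigD1 j)//= ltr_wpDr ?sumr_ge0//; first by case/andP: (w01 j).
rewrite -w1 [ltRHS](bigID (mem J)) /= ltrDl (bigD1 j')//=.
by rewrite ltr_wpDr ?sumr_ge0//; case/andP: (w01 j').
Qed.

(** * Extremal vectors *)

Lemma uniform_probE (R : realType) (A : set R) :
  measurable A ->
  uniform_prob (@ltr01 R) A = lebesgue_measure (A `&` `[0, 1]).
Proof.
move=> mA; rewrite /uniform_prob integral_uniform_pdf.
rewrite (eq_integral (cst 1%E)) => [|x].
  by rewrite integral_cst ?mul1e//; exact: measurableI.
by rewrite inE /= in_itv => -[_ x01]; rewrite /uniform_pdf x01 subr0 invr1.
Qed.

(** The complement of [E] lies, up to the two endpoints of [0, 1], in the open
    interval of length [l] and centre c / 2. *)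
Lemma uniform_prob_ge (R : realType) (E : set R) (c l : R) :
  measurable E -> 0 <= l ->
  (forall u, 0 < u < 1 -> l <= `|2 * u - c| -> E u) ->
  ((1 - l)%:E <= uniform_prob (@ltr01 R) E)%E.
Proof.
move=> mE l0 farE.
have ncE : (uniform_prob (@ltr01 R) (~` E) <= l%:E)%E.
  rewrite uniform_probE; last exact: measurableC.
  pose J : set R := `](c - l) / 2, (c + l) / 2[%classic.
  have mJ : measurable J by exact: measurable_itv.
  have JE : (lebesgue_measure J <= l%:E)%E.
    rewrite /J lebesgue_measure_itv /= lte_fin; case: ifP => _.
      by rewrite EFinN -EFinB lee_fin; lra.
    by rewrite lee_fin.
  have endpoints : lebesgue_measure ([set 0] `|` [set 1] : set R) = 0%E.
    by rewrite measureU0//; exact: lebesgue_measure_set1.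
  apply: (@le_trans _ _ (lebesgue_measure (J `|` ([set 0] `|` [set 1])))).
    apply: le_measure; rewrite ?inE.
    - by apply: measurableI; [exact: measurableC|exact: measurable_itv].
    - by do ![apply: measurableU => //].
    - move=> u [nEu /=]; rewrite in_itv /= => /andP[u0 u1].
      have [u01|] := boolP (0 < u < 1).
        left; rewrite /J /= in_itv /=.
        have [/(farE u u01)//|] := leP l `|2 * u - c|.
        by rewrite ltr_norml => /andP[? ?]; apply/andP; split; lra.
      rewrite negb_and -!leNgt => /orP[u0'|u1']; right.
        by left; apply/eqP; rewrite /= eq_le u0 u0'.
      by right; apply/eqP; rewrite /= eq_le u1 u1'.
  by rewrite measureU0// ; apply: measurableU.
have PE : uniform_prob (@ltr01 R) E \is a fin_num by exact: fin_num_measure.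
have {}ncE : (1 - uniform_prob (@ltr01 R) E <= l%:E)%E.
  by rewrite -(probability_setC (uniform_prob (@ltr01 R)) mE).
move: ncE; rewrite -(fineK PE) -EFinB !lee_fin; lra.
Qed.

(** For J = [n] one has W = 1, and the bound is the exact value p; so the
    comonotone component needs no separate treatment. *)
Lemma extremal_vector_law_ge (R : realType) (n : nat) (r p : R)
    (w : 'I_n -> R) (J : {set 'I_n}) (W := \sum_(j in J) w j) :
  r <= -1 -> 0 < p < 1 -> simplex w ->
  ((1 - Num.sqrt (1 - 2 * p + p ^+ 2 * (1 - 2 * W) ^+ 2))%:E <=
   uniform_prob (@ltr01 R) [set u | (weighted_mean r w
     (fun j => if j \in J then u else 1 - u) <= p)%R])%E.
Proof.
move=> r1 p01 wS; have [_ w1] := wS.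
have W01 : 0 <= W <= 1 by exact: simplex_sum_bounds.
apply: (@uniform_prob_ge _ _ (1 - p * (1 - 2 * W))).
- have mY (j : 'I_n) :
      measurable_fun setT (fun u : R => if j \in J then u else 1 - u).
    by case: (j \in J) => //; exact: measurable_funB.
  have mM := measurableT_comp (measurable_weighted_mean r w)
    (measurable_vector mY).
  have := mM measurableT _ (measurable_itv `]-oo, p]).
  by rewrite setTI.
- apply: sqrtr_ge0.
- move=> u u01 far; rewrite /= weighted_mean_two_valued// -/W.
  case/andP: (u01) => u0 u1; rewrite -subr_gt0 in u1.
  apply: le_trans (power_mean_le_harmonic r1 W01 u0 u1) _.
  by apply: harmonic_mean_le => //; case/andP: p01.
Qed.

(** * Index sets read off binary digits *)

(** By induction on the number of digits: either the last digit is nonzero, or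
    k is even and a nonzero digit of k / 2 is one of k. *)
Lemma binary_digit_neq0 (n k : nat) :
  (0 < k < 2 ^ n)%N -> exists j : 'I_n, binary_digit k j.
Proof.
elim: n k => [|n IHn] k; first by case: k.
case/andP=> k_gt0 k_lt.
have [k_odd|k_even] := boolP (odd k).
  by exists ord_max; rewrite /binary_digit subnn expn0 divn1.
have kE : k = (k./2 * 2)%N by rewrite muln2 even_halfK.
have [|j jP] := IHn k./2.
  move: k_gt0 k_lt; rewrite {1 2}kE expnSr ltn_pmul2r// muln_gt0 andbT.
  by move=> -> ->.
exists (widen_ord (leqnSn n) j); move: jP; rewrite /binary_digit.
by rewrite /= -divn2 -divnMA -expnS subSn.
Qed.

(** The leading digit vanishes below 2^(n-1), so every index set contains the
    first index. *)
Lemma binary_digit_leading (n : nat) (k : nat) (j : 'I_n) :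
  (k < 2 ^ n.-1)%N -> j = 0%N :> nat -> ~~ binary_digit k j.
Proof. by move=> k_lt j0; rewrite /binary_digit j0 subn1 divn_small. Qed.

Lemma extremal_index_set_proper (n : nat) (i : 'I_(2 ^ n.-1)) :
  i != comonotone_index n -> exists j, j \notin extremal_index_set i.
Proof.
move=> i_neq0; have i_gt0 : (0 < i)%N.
  by rewrite lt0n; apply: contraNneq i_neq0 => i0; apply/eqP/val_inj.
have [|j jP] := @binary_digit_neq0 n i.
  by rewrite i_gt0 (leq_trans (ltn_ord i))// leq_exp2l// leq_pred.
by exists j; rewrite inE negbK.
Qed.

(** * Extremal mixtures *)

Theorem theorem1 (R : realType) (d : measure_display) (T : measurableType d)
    (P : probability T R) (n : nat) (r : R) (U : 'I_n -> {RV P >-> R})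
    (a : 'I_(2 ^ n.-1) -> R) :
  (2 <= n)%N ->
  r <= -1 ->
  simplex a ->
  a (comonotone_index n) < 1 ->
  joint_cdf P (fun j => U j) = extremal_mixture_copula a ->
  forall w : 'I_n -> R, open_simplex w ->
    strictly_sub_uniform P (fun t => weighted_mean r w (fun j => U j t)).
Proof.
move=> n2 r1 [a01 a1] a0_lt1 UC w wS; have wS' := wS.1.
have a_ge0 i : 0 <= a i by case/andP: (a01 i).
have mU : measurable_fun setT
    (fun t => (fun j => U j t) : orthant_space R n).
  by apply: measurable_vector => j; exact: measurable_funPT.
split.
- exact: measurableT_comp (measurable_weighted_mean r w) mU.
- by move=> t; exact: powR_ge0.
move=> p p01.
pose Y (i : 'I_(2 ^ n.-1)) (j : 'I_n) (u : R) :=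
  if j \in extremal_index_set i then u else 1 - u.
have mY i j : measurable_fun setT (Y i j).
  by rewrite /Y; case: (j \in _) => //; exact: measurable_funB.
pose A : set (orthant_space R n) := [set x | weighted_mean r w x <= p].
have mA : measurable A.
  have := measurable_weighted_mean r w measurableT (measurable_itv `]-oo, p]).
  by rewrite setTI.
have PA := mixture_law_of_cdf (X := fun j => U j) (Y := Y)
  (Q := uniform_prob (@ltr01 R)) (a := a)
  (fun j => measurable_funPT (U j)) mY a_ge0
  (fun x => congr1 (@^~ x) UC) mA.
rewrite [ltRHS]PA.
pose W (i : 'I_(2 ^ n.-1)) := \sum_(j in extremal_index_set i) w j.
pose q i := 1 - Num.sqrt (1 - 2 * p + p ^+ 2 * (1 - 2 * W i) ^+ 2).
have qA i : ((q i)%:E <= uniform_prob (@ltr01 R) [set u | A (Y i ^~ u)])%E.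
  exact: extremal_vector_law_ge.
have Q_fin i : uniform_prob (@ltr01 R) [set u | A (Y i ^~ u)] \is a fin_num.
  apply: fin_num_measure.
  by rewrite -[X in measurable X]setTI; exact: (measurable_vector (mY i)).
pose Q i := fine (uniform_prob (@ltr01 R) [set u | A (Y i ^~ u)]).
have q_le i : q i <= Q i by rewrite -lee_fin /Q fineK.
rewrite (eq_bigr (fun i => (a i * Q i)%:E)) => [|i _]; last first.
  by rewrite EFinM /Q fineK.
rewrite sumEFin lte_fin.
have pQ i : p <= Q i.
  have W01 : 0 <= W i <= 1 by exact: simplex_sum_bounds.
  apply: le_trans (q_le i); rewrite /q.
  by have := excluded_length_le W01 p01; lra.
(* Otherwise all the mass would sit at the comonotone index. *)
have [i i_neq0 ai_gt0] : exists2 i, i != comonotone_index n & 0 < a i.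
  apply/not_exists2P => a_eq0; move: a0_lt1.
  rewrite -a1 (bigD1 (comonotone_index n))//= big1 ?addr0 ?ltxx// => i i_neq0.
  have [/(_ i_neq0)//|/negP] := a_eq0 i.
  by rewrite lt0r a_ge0 andbT negbK => /eqP.
have pQi : p < Q i.
  have [j' j'J] := extremal_index_set_proper i_neq0.
  have n0 : (0 < n)%N by exact: ltnW.
  have jJ : Ordinal n0 \in extremal_index_set i.
    by rewrite inE binary_digit_leading.
  apply: lt_le_trans (q_le i); rewrite /q.
  have := excluded_length_lt (mixed_weight_bounds wS jJ j'J) p01.
  by rewrite -/(W i); lra.
rewrite -[ltLHS]mul1r -a1 mulr_suml (bigD1 i)//= [ltRHS](bigD1 i)//=.
apply: ltr_leD; first by rewrite (ltr_pM2l ai_gt0).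
by apply: ler_sum => k _; apply: ler_wpM2l; [exact: a_ge0|exact: pQ].
Qed.
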